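(* Let $T\in\mathcal C(H_1,H_2)$, i.e. let $T$ be a densely defined closed linear operator with domain $D(T)\subseteq H_1$ and values in $H_2$. Then $T$ attains its reduced minimum (there exists $x_0\in C(T)$ with $\|x_0\|=1$ and $\|Tx_0\|=\gamma(T)$) if and only if its Moore-Penrose inverse $T^{\dagger}$ is bounded and attains its norm (there exists $y_0\in H_2$ with $\|y_0\|=1$ and $\|T^{\dagger}y_0\|=\|T^{\dagger}\|$).
   Context: $H_1,H_2$ are infinite dimensional complex Hilbert spaces. $\mathcal C(H_1,H_2)$ denotes the class of densely defined closed linear operators from a dense subspace $D(T)\subseteq H_1$ into $H_2$. $N(T)$ and $R(T)$ denote the null space and range of $T$. The carrier of $T$ is $C(T):=D(T)\cap N(T)^{\perp}$. The reduced minimum modulus of $T$ is $\gamma(T):=\inf\{\|Tx\|: x\in C(T),\ \|x\|=1\}$. The Moore-Penrose inverse $T^{\dagger}$ of $T$ is the unique densely defined closed operator from $H_2$ to $H_1$ with domain $D(T^{\dagger})=R(T)\oplus^{\perp}R(T)^{\perp}$ such that $TT^{\dagger}y=P_{\overline{R(T)}}\,y$ for all $y\in D(T^{\dagger})$, $T^{\dagger}Tx=P_{N(T)^{\perp}}\,x$ for all $x\in D(T)$, and $N(T^{\dagger})=R(T)^{\perp}$, where $P_M$ denotes the orthogonal projection onto a closed subspace $M$.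
   Formalization: The operator T is assumed nonzero: for T = 0 the carrier C(T) = {0} has no unit vector, so T does not attain its reduced minimum, while T† = 0 is bounded and attains its norm, so the stated equivalence fails. *)

(* Defs.v *)
From HB Require Import structures.
From mathcomp Require Import all_boot all_order all_algebra.
From mathcomp Require Import sesquilinear complex.
From mathcomp Require Import all_classical all_reals all_analysis.

Set Implicit Arguments.
Unset Strict Implicit.
Unset Printing Implicit Defensive.

Import Order.TTheory GRing.Theory Num.Theory.
Import numFieldNormedType.Exports.

Local Open Scope classical_set_scope.
Local Open Scope ring_scope.
Local Open Scope complex_scope.

(* The inner product is linear in its first argument and conjugate-linear in
   its second one. *)
HB.mixin Record CompleteNormedModule_isHilbert (R : realType) (H : Type)
    of CompleteNormedModule R[i] H := {
  inner : {dot H for (@Num.conj R[i])} ;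
  inner_normE : forall x : H, inner x x = `|x| ^+ 2
}.

#[short(type="hilbertType")]
HB.structure Definition Hilbert (R : realType) :=
  { H of CompleteNormedModule_isHilbert R H & CompleteNormedModule R[i] H }.

Section Hilbert.
Context {R : realType}.

(* The library norm takes its (real) values in R[i]. *)
Definition hnorm {H : hilbertType R} (x : H) : R := complex.Re `|x|.

Lemma hnormE (H : hilbertType R) (x : H) : (hnorm x)%:C = `|x|.
Proof. by rewrite /hnorm RRe_real // normr_real. Qed.

Definition infinite_dim (H : hilbertType R) : Prop :=
  ~ exists s : seq H,
      forall x : H, exists c : 'I_(size s) -> R[i], x = \sum_i c i *: s`_i.

Definition orth {H : hilbertType R} (A : set H) : set H :=
  [set x | forall a, A a -> inner x a = 0].

(* p = P_M x *)
Definition is_orthproj {H : hilbertType R} (M : set H) (x p : H) : Prop :=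
  M p /\ orth M (x - p).

(* The values of [op] outside [dom] carry no information. *)
Record closed_op (H1 H2 : hilbertType R) := ClosedOp {
  dom : set H1 ;
  op :> H1 -> H2 ;
  dom0 : dom 0 ;
  dom_linear : forall (a : R[i]) x y, dom x -> dom y -> dom (a *: x + y) ;
  op_linear : forall (a : R[i]) x y, dom x -> dom y ->
    op (a *: x + y) = a *: op x + op y ;
  dom_dense : dense dom ;
  graph_closed : closed [set p : H1 * H2 | dom p.1 /\ p.2 = op p.1]
}.

Section Operator.
Context {H1 H2 : hilbertType R}.
Implicit Type T : closed_op H1 H2.

Definition null_space T : set H1 := [set x | dom T x /\ T x = 0].

Definition range_space T : set H2 := [set T x | x in dom T].

Definition carrier T : set H1 := dom T `&` orth (null_space T).

(* If T = 0 then [carrier T] is {0}, and this is the infimum of the empty set,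
   for which [inf] is 0; hence theorems about it assume T <> 0. *)
Definition reduced_min_modulus T : R :=
  inf [set hnorm (T x) | x in [set x | carrier T x /\ hnorm x = 1]].

Definition attains_reduced_min T : Prop :=
  exists x0, [/\ carrier T x0, hnorm x0 = 1 &
                 hnorm (T x0) = reduced_min_modulus T].

Definition bounded_op T : Prop :=
  exists M : R, forall x, dom T x -> hnorm (T x) <= M * hnorm x.

(* This is the operator norm only when T is bounded: [sup] is 0 on unbounded
   sets. *)
Definition op_norm T : R :=
  sup [set hnorm (T x) | x in [set x | dom T x /\ hnorm x <= 1]].

Definition attains_norm T : Prop :=
  exists x0, [/\ dom T x0, hnorm x0 = 1 & hnorm (T x0) = op_norm T].

End Operator.

Record is_moore_penrose (H1 H2 : hilbertType R)
    (T : closed_op H1 H2) (S : closed_op H2 H1) : Prop := IsMoorePenrose {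
  mp_dom : dom S =
    [set y + z | y in range_space T & z in orth (range_space T)] ;
  mp_mulTS : forall y, dom S y ->
    dom T (S y) /\ is_orthproj (closure (range_space T)) y (T (S y)) ;
  mp_mulST : forall x, dom T x ->
    dom S (T x) /\ is_orthproj (orth (null_space T)) x (S (T x)) ;
  mp_ker : null_space S = orth (range_space T)
}.

End Hilbert.

(* Main.v *)
(* If x lies in C(T) then T^dagger (T x) = x, while for y in D(T^dagger) the
   vector T^dagger y lies in C(T) and |T (T^dagger y)| <= |y|. So T^dagger maps
   onto C(T) and reverses the inequalities: c |x| <= |T x| on C(T) is the same
   as |T^dagger y| <= c^-1 |y| on D(T^dagger). A minimiser x0 of T on C(T) gives
   the maximiser T x0 / gamma(T) of T^dagger, and a maximiser y0 of T^dagger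
   gives the minimiser T^dagger y0 / |T^dagger|. *)
Require Import Defs.
From mathcomp Require Import all_boot all_order all_algebra.
From mathcomp Require Import sesquilinear complex.
From mathcomp Require Import all_classical all_reals all_analysis.

Import Order.TTheory GRing.Theory Num.Theory.

Local Open Scope ring_scope.

Section Hilbert.
Context {R : realType}.

(** The element [m] witnesses both side conditions on [sup]: that [A] is nonempty and that it is
    bounded above. *)
Lemma sup_maximum (A : set R) (m : R) : A m -> ubound A m -> sup A = m.
Proof.
move=> Am ubm; apply/eqP; rewrite eq_le; apply/andP; split.
  by apply: ge_sup => //; exists m.
by apply: ub_le_sup => //; exists m.
Qed.

Lemma inf_minimum (A : set R) (m : R) : A m -> lbound A m -> inf A = m.
Proof.
move=> Am lbm; apply/eqP; rewrite eq_le; apply/andP; split.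
  by apply: ge_inf => //; exists m.
by apply: lb_le_inf => //; exists m.
Qed.

Section Space.
Context {H : hilbertType R}.
Implicit Types (x y p : H) (A M : set H).

Lemma hnorm_ge0 x : 0 <= hnorm x.
Proof. by rewrite -lecR hnormE; exact: normr_ge0. Qed.

Lemma hnorm_eq0 x : (hnorm x == 0) = (x == 0).
Proof. by rewrite -[x == 0]normr_eq0 -hnormE fmorph_eq0. Qed.

Lemma hnorm0 : hnorm (0 : H) = 0.
Proof. by apply/eqP; rewrite hnorm_eq0. Qed.

Lemma hnorm_gt0 x : (0 < hnorm x) = (x != 0).
Proof. by rewrite lt_def hnorm_ge0 hnorm_eq0 andbT. Qed.

Lemma hnormZ (a : R) x : hnorm (a%:C%C *: x) = `|a| * hnorm x.
Proof.
apply: complexI; rewrite hnormE normrZ rmorphM /= hnormE.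
by rewrite normc_def /= expr0n addr0 sqrtr_sqr.
Qed.

Lemma hnorm_normalize x : x != 0 -> hnorm ((hnorm x)^-1%:C%C *: x) = 1.
Proof.
move=> x0; rewrite hnormZ ger0_norm ?invr_ge0 ?hnorm_ge0 //.
by rewrite mulVf // hnorm_eq0.
Qed.

Lemma orthZ A (a : R[i]) x : orth A x -> orth A (a *: x).
Proof. by move=> ox b Ab; rewrite linearZl_LR /= ox // mulr0. Qed.

Lemma orthB A x y : orth A x -> orth A y -> orth A (x - y).
Proof. by move=> ox oy b Ab; rewrite linearBl /= ox // oy // subr0. Qed.

Lemma orth_self_eq0 A x : A x -> orth A x -> x = 0.
Proof.
by move=> Ax /(_ _ Ax); rewrite inner_normE => /eqP; rewrite sqrf_eq0 normr_eq0
  => /eqP.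
Qed.

(** Pythagoras: [x - p] is orthogonal to [p], so $\|x\|^2 = \|x-p\|^2 + \|p\|^2$. *)
Lemma is_orthproj_hnorm_le M x p : is_orthproj M x p -> hnorm p <= hnorm x.
Proof.
case=> Mp /(_ _ Mp) op; rewrite -lecR !hnormE -ler_sqr ?nnegrE //.
rewrite -!inner_normE -[in leRHS](subrK p x) dnormD /= op rmorph0 !addr0.
by rewrite lerDr dnorm_ge0.
Qed.

End Space.

Section Operator.
Context {H1 H2 : hilbertType R}.
Variable T : closed_op H1 H2.

Lemma domZ (a : R[i]) x : dom T x -> dom T (a *: x).
Proof. by move=> dx; rewrite -[_ *: _]addr0; apply: dom_linear (dom0 T). Qed.

Lemma op0 : T 0 = 0.
Proof.
have := op_linear 1 (dom0 T) (dom0 T).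
by rewrite !scale1r addr0 => /eqP; rewrite -subr_eq0 opprD addrA subrr sub0r
  oppr_eq0 => /eqP.
Qed.

Lemma opZ (a : R[i]) x : dom T x -> T (a *: x) = a *: T x.
Proof.
by move=> dx; rewrite -[_ *: x]addr0 op_linear ?op0 ?addr0 //; apply: dom0.
Qed.

Lemma opD x y : dom T x -> dom T y -> T (x + y) = T x + T y.
Proof. by move=> dx dy; rewrite -[x in LHS]scale1r op_linear // scale1r. Qed.

Lemma carrierZ (a : R[i]) x : carrier T x -> carrier T (a *: x).
Proof. by case=> dx ox; split; [apply: domZ | apply: orthZ]. Qed.

Lemma carrier_ker0 x : carrier T x -> T x = 0 -> x = 0.
Proof. by case=> dx ox Tx0; apply: orth_self_eq0 ox. Qed.

(** Homogeneity extends the bound from unit vectors to the whole carrier; only the zero vector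
    cannot be normalised. *)
Lemma reduced_min_modulus_le x :
  carrier T x -> reduced_min_modulus T * hnorm x <= hnorm (T x).
Proof.
move=> Cx; have [->|x0] := eqVneq x 0.
  by rewrite hnorm0 mulr0 hnorm_ge0.
rewrite -ler_pdivlMr ?hnorm_gt0 // mulrC; apply: ge_inf.
  by exists 0 => _ [y _ <-]; exact: hnorm_ge0.
exists ((hnorm x)^-1%:C%C *: x).
  by split; [exact: carrierZ | exact: hnorm_normalize].
rewrite opZ; last by case: Cx.
by rewrite hnormZ ger0_norm // invr_ge0 hnorm_ge0.
Qed.

Lemma op_norm_ge x : bounded_op T -> dom T x ->
  hnorm (T x) <= op_norm T * hnorm x.
Proof.
move=> [M TM] dx; have [->|x0] := eqVneq x 0.
  by rewrite op0 !hnorm0 mulr0.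
rewrite -ler_pdivrMr ?hnorm_gt0 // mulrC; apply: ub_le_sup.
  (* The sign of [M] is unknown and [y] may have norm below 1, so the bound over the unit ball is
     [|M|]. *)
  exists `|M| => _ [y [dy y1] <-]; apply: le_trans (TM _ dy) _.
  apply: le_trans (ler_norm _) _; rewrite normrM ler_piMr //.
  by rewrite ger0_norm ?hnorm_ge0.
exists ((hnorm x)^-1%:C%C *: x).
  by split; [exact: domZ | rewrite hnorm_normalize].
by rewrite opZ // hnormZ ger0_norm // invr_ge0 hnorm_ge0.
Qed.

End Operator.

Section MoorePenrose.
Context {H1 H2 : hilbertType R}.
Variables (T : closed_op H1 H2) (S : closed_op H2 H1).
Hypothesis TS : is_moore_penrose T S.

(** Split [y] as $Tx + z$ with $z \in R(T)^\perp = N(S)$: then $Sy = STx$, which is the projection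
    of $x$ onto $N(T)^\perp$. *)
Lemma moore_penrose_carrier y : dom S y -> carrier T (S y).
Proof.
move=> dy; split; first by case: (mp_mulTS TS dy).
have := dy; rewrite {1}(mp_dom TS) => -[_ [x dx <-] [z oz <-]].
have [dSTx [oSTx _]] := mp_mulST TS dx.
have [dz Sz0] : null_space S z by rewrite (mp_ker TS).
by rewrite opD // Sz0 addr0.
Qed.

(** The difference $x - STx$ lies in $N(T)^\perp$ and is also orthogonal to it. *)
Lemma moore_penroseK x : carrier T x -> S (T x) = x.
Proof.
case=> dx ox; have [_ [oSTx ooSTx]] := mp_mulST TS dx.
apply/esym/eqP; rewrite -subr_eq0; apply/eqP.
by apply: orth_self_eq0 ooSTx; apply: orthB.
Qed.

Lemma moore_penrose_hnorm_le y : dom S y -> hnorm (T (S y)) <= hnorm y.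
Proof. by move=> /(mp_mulTS TS) [_]; apply: is_orthproj_hnorm_le. Qed.

(** Otherwise $Tx$ would lie in both $R(T)$ and $N(S) = R(T)^\perp$. *)
Lemma moore_penrose_neq0 x : dom T x -> T x <> 0 -> S (T x) != 0.
Proof.
move=> dx Tx0; apply/eqP => STx0; apply: Tx0.
apply: (@orth_self_eq0 _ (range_space T)); first by exists x.
by rewrite -(mp_ker TS); split=> //; case: (mp_mulST TS dx).
Qed.

Lemma attains_reduced_min_moore_penrose :
  attains_reduced_min T -> bounded_op S /\ attains_norm S.
Proof.
move=> [x0 [Cx0 x01 Tx0]]; set g := reduced_min_modulus T in Tx0.
(* Attainment enters here: [g] is the norm of $Tx_0$ for a unit vector of the carrier, where $T$ is
   injective. *)
have g_gt0 : 0 < g.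
  rewrite -Tx0 hnorm_gt0; apply/eqP => /(carrier_ker0 T x0 Cx0) /eqP.
  by rewrite -hnorm_eq0 x01 oner_eq0.
have gi_ge0 : 0 <= g^-1 by rewrite invr_ge0 ltW.
have Sle y : dom S y -> hnorm (S y) <= g^-1 * hnorm y.
  move=> dy; rewrite mulrC ler_pdivlMr // mulrC.
  apply: le_trans (moore_penrose_hnorm_le y dy).
  exact/reduced_min_modulus_le/moore_penrose_carrier.
split; first by exists g^-1.
have dTx0 : dom S (T x0) by case: Cx0 => /(mp_mulST TS) [].
pose y0 := g^-1%:C%C *: T x0.
have dy0 : dom S y0 by apply: domZ.
have y01 : hnorm y0 = 1.
  by rewrite hnormZ Tx0 ger0_norm // mulVf ?gt_eqF.
have Sy0 : hnorm (S y0) = g^-1.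
  by rewrite opZ // moore_penroseK // hnormZ x01 mulr1 ger0_norm ?invr_ge0 ?ltW.
exists y0; split => //; rewrite Sy0; apply/esym/sup_maximum.
  by exists y0 => //; split => //; rewrite y01.
move=> _ [y [dy y1] <-]; apply: le_trans (Sle _ dy) _.
by rewrite ler_piMr.
Qed.

Lemma moore_penrose_attains_reduced_min : (exists2 x, dom T x & T x <> 0) ->
  bounded_op S -> attains_norm S -> attains_reduced_min T.
Proof.
move=> [x dx Tx0] Sbd [y0 [dy0 y01 Sy0]]; set s := op_norm S in Sy0.
(* For $Tx \neq 0$ one has $0 < \|STx\| \le s\|Tx\|$; this is where $T \neq 0$ is used. *)
have s_gt0 : 0 < s.
  have [dTx _] := mp_mulST TS dx.
  have := op_norm_ge S _ Sbd dTx.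
  rewrite -/s; have := moore_penrose_neq0 _ dx Tx0; rewrite -hnorm_gt0.
  move=> /lt_le_trans /[apply]; rewrite pmulr_lgt0 // hnorm_gt0.
  exact/eqP.
have si_ge0 : 0 <= s^-1 by rewrite invr_ge0 ltW.
(* Divide $1 = \|x_1\| = \|STx_1\| \le s\|Tx_1\|$ by $s$. *)
have lb x1 : carrier T x1 -> hnorm x1 = 1 -> s^-1 <= hnorm (T x1).
  move=> Cx1 x11; rewrite -[s^-1]mul1r ler_pdivrMr // mulrC -{1}x11.
  rewrite -{1}(moore_penroseK x1 Cx1); apply: op_norm_ge => //.
  by case: Cx1 => /(mp_mulST TS) [].
pose x0 := s^-1%:C%C *: S y0.
have Cx0 : carrier T x0 by exact/carrierZ/moore_penrose_carrier.
have x01 : hnorm x0 = 1.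
  by rewrite hnormZ Sy0 ger0_norm // mulVf ?gt_eqF.
have Tx0E : hnorm (T x0) = s^-1.
  (* [lb] gives one inequality; the other is $\|TSy_0\| \le \|y_0\| = 1$, scaled by $s^{-1}$. *)
  apply/eqP; rewrite eq_le lb // andbT opZ; last by case: (mp_mulTS TS dy0).
  rewrite hnormZ ger0_norm // ler_piMr //.
  by rewrite -y01 moore_penrose_hnorm_le.
exists x0; split => //; rewrite Tx0E; apply/esym/inf_minimum.
  by exists x0.
by move=> _ [x1 [Cx1 x11] <-]; apply: lb.
Qed.

End MoorePenrose.
End Hilbert.

Theorem theorem3p2 (R : realType) (H1 H2 : hilbertType R)
    (infH1 : infinite_dim H1) (infH2 : infinite_dim H2)
    (T : closed_op H1 H2) (T_neq0 : exists2 x, dom T x & T x <> 0)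
    (Tdag : closed_op H2 H1) (TdagP : is_moore_penrose T Tdag) :
  attains_reduced_min T <-> bounded_op Tdag /\ attains_norm Tdag.
Proof.
split; first exact: attains_reduced_min_moore_penrose.
by case; apply: moore_penrose_attains_reduced_min.
Qed.
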